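(* Let $r_1,\dots,r_M:\mathbb{R}^d\to\mathbb{R}$ be twice differentiable, let $r=\frac1M\sum_{m=1}^M r_m$, and let $x_*$ be a minimizer of $r$ over $\mathbb{R}^d$. Let $\delta>0$ and suppose that for every $m\in\{1,\dots,M\}$ the function $r_m$ is $\delta$-related to $r$. Then for every $m\in\{1,\dots,M\}$ and every $x\in\mathbb{R}^d$, $$\|\nabla r_m(x)-\nabla r(x)\|^2\le \sigma_{sim}^2+2\delta^2\|x-x_*\|^2,\qquad\text{where } \sigma_{sim}^2=2\max_{1\le m\le M}\|\nabla r_m(x_* )\|^2 .$$
   Context: A function $f_m$ is called $\delta$-related to $f$ if $\|\nabla^2 f_m(x)-\nabla^2 f(x)\|\le\delta$ for all $x\in\mathbb{R}^d$ (operator norm). $\|\cdot\|$ on vectors is the Euclidean norm. *)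

(* Defs.v *)
From mathcomp Require Import all_boot all_order all_algebra.
From mathcomp Require Import boolp classical_sets reals topology normedtype derive.
Set Implicit Arguments.
Unset Strict Implicit.
Unset Printing Implicit Defensive.
Import Order.TTheory GRing.Theory Num.Theory.
Import numFieldNormedType.Exports.
Local Open Scope classical_set_scope.
Local Open Scope ring_scope.

(* R^d is 'rV[R]_d. The canonical norm `|_| on 'rV[R]_d is the sup norm, so the
   Euclidean norm is defined separately; both induce the same topology and hence
   the same notion of differentiability. *)
Definition enorm (R : realType) (d : nat) (v : 'rV[R]_d) : R :=
  Num.sqrt (\sum_(j < d) v 0 j ^+ 2).

(* The operator norm of v |-> v *m A with respect to enorm. The set is nonempty
   (take v = 0) and bounded above, so sup is the true supremum. *)
Definition opnorm (R : realType) (d : nat) (A : 'M[R]_d) : R :=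
  sup [set enorm (v *m A) | v in [set v : 'rV[R]_d | enorm v <= 1]].

Definition grad (R : realType) (d : nat) (f : 'rV[R]_d -> R) (x : 'rV[R]_d) :
    'rV[R]_d :=
  \row_(j < d) 'D_(delta_mx 0 j) f x.

(* 'J acts on row vectors from the right: v *m hess f x is the differential of
   grad f at x applied to v. *)
Definition hess (R : realType) (d : nat) (f : 'rV[R]_d -> R) (x : 'rV[R]_d) :
    'M[R]_d :=
  'J (grad f) x.

Definition twice_differentiable (R : realType) (d : nat) (f : 'rV[R]_d -> R) :
    Prop :=
  (forall x, differentiable f x) /\ (forall x, differentiable (grad f) x).

Definition related (R : realType) (d : nat) (delta : R)
    (g f : 'rV[R]_d -> R) : Prop :=
  forall x, opnorm (hess g x - hess f x) <= delta.

Definition average (R : realType) (d M : nat) (r : 'I_M -> 'rV[R]_d -> R) :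
    'rV[R]_d -> R :=
  fun x => M%:R^-1 * \sum_(m < M) r m x.

Definition minimizer (R : realType) (d : nat) (f : 'rV[R]_d -> R)
    (xs : 'rV[R]_d) : Prop :=
  forall x, f xs <= f x.

(* The base value 0 of the iterated maximum is harmless when 0 < M:
   the terms are nonnegative. *)
Definition sigma_sim_sq (R : realType) (d M : nat)
    (r : 'I_M -> 'rV[R]_d -> R) (xs : 'rV[R]_d) : R :=
  2 * \big[Num.max/0]_(m < M) enorm (grad (r m) xs) ^+ 2.

(* Main.v *)
(* Put h := grad r_m - grad r, whose Jacobian has operator norm at most delta.
   Applying the scalar mean value theorem to t |-> <h (xs + t (x - xs)), u> with
   u := h x - h xs gives |u|^2 <= delta |x - xs| |u|, so h is delta-Lipschitz
   about xs.  Since grad r vanishes at the minimizer, h xs = grad r_m xs, and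
   |h x|^2 <= 2 |h xs|^2 + 2 |h x - h xs|^2. *)
Require Import Defs.
From mathcomp Require Import all_boot all_order all_algebra.
From mathcomp Require Import boolp classical_sets reals topology normedtype derive.
From mathcomp Require Import functions realfun ring lra.
Import Order.TTheory GRing.Theory Num.Theory.
Import numFieldNormedType.Exports.
Local Open Scope ring_scope.

(** Expanding the nonnegative sum of the squares [(C * a i - B * b i) ^+ 2] gives
    [C * (A * C - B ^+ 2)], and a positive [C] can be cancelled. If [C = 0], every [b i]
    vanishes. *)
Lemma cauchy_schwarz_sum (R : realFieldType) (n : nat) (a b : 'I_n -> R) :
  (\sum_(i < n) a i * b i) ^+ 2 <= (\sum_(i < n) a i ^+ 2) * \sum_(i < n) b i ^+ 2.
Proof.
set A := \sum_(i < n) a i ^+ 2; set B := \sum_(i < n) a i * b i.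
set C := \sum_(i < n) b i ^+ 2.
have C_ge0 : 0 <= C by apply: sumr_ge0 => i _; exact: sqr_ge0.
have [C0|C_neq0] := eqVneq C 0.
  have b0 i : b i = 0.
    apply/eqP; rewrite -sqrf_eq0.
    by have /psumr_eq0P-> // := C0 => j _; exact: sqr_ge0.
  by rewrite /B big1 ?expr0n /= ?C0 ?mulr0 // => i _; rewrite b0 mulr0.
have : 0 <= \sum_(i < n) (C * a i - B * b i) ^+ 2.
  by apply: sumr_ge0 => i _; exact: sqr_ge0.
have -> : \sum_(i < n) (C * a i - B * b i) ^+ 2 = C * (A * C - B ^+ 2).
  rewrite (eq_bigr (fun i => C ^+ 2 * a i ^+ 2 - C * B * 2 * (a i * b i)
    + B ^+ 2 * b i ^+ 2)) => [|i _]; last by ring.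
  by rewrite big_split sumrB -!mulr_sumr -/A -/B -/C /=; ring.
by rewrite pmulr_rge0 ?subr_ge0 // lt0r C_neq0.
Qed.

Section EuclideanNorm.
Context {R : realType} {d : nat}.
Implicit Types (u v : 'rV[R]_d) (A : 'M[R]_d).

Lemma enorm_ge0 v : 0 <= enorm v.
Proof. exact: sqrtr_ge0. Qed.

Lemma enorm_sqr v : enorm v ^+ 2 = \sum_(j < d) v 0 j ^+ 2.
Proof. by rewrite sqr_sqrtr // sumr_ge0 // => j _; exact: sqr_ge0. Qed.

Lemma enorm0 : enorm (0 : 'rV[R]_d) = 0.
Proof. by rewrite /enorm big1 ?sqrtr0 // => j _; rewrite mxE expr0n. Qed.

Lemma enorm_eq0 v : enorm v = 0 -> v = 0.
Proof.
move=> v0; apply/rowP => j; rewrite mxE; apply/eqP; rewrite -sqrf_eq0.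
have /psumr_eq0P -> // : \sum_(j < d) v 0 j ^+ 2 = 0.
  by rewrite -enorm_sqr v0 expr0n.
by move=> i _; exact: sqr_ge0.
Qed.

Lemma enormZ (c : R) v : 0 <= c -> enorm (c *: v) = c * enorm v.
Proof.
move=> c_ge0; apply/eqP.
rewrite -(eqrXn2 (n := 2)) ?mulr_ge0 ?enorm_ge0 // exprMn !enorm_sqr mulr_sumr.
by apply/eqP/eq_bigr => j _; rewrite mxE exprMn.
Qed.

(** Coordinatewise, the gap between the two sides is the square of [u 0 j - v 0 j]. Both factors 2
    in the final bound come from here. *)
Lemma enormD_sqr u v :
  enorm (u + v) ^+ 2 <= 2 * enorm u ^+ 2 + 2 * enorm v ^+ 2.
Proof.
rewrite !enorm_sqr !mulr_sumr -big_split; apply: ler_sum => j _ /=.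
rewrite mxE; have := sqr_ge0 (u 0 j - v 0 j); lra.
Qed.

Lemma sum_mul_le_enorm u v : \sum_(j < d) u 0 j * v 0 j <= enorm u * enorm v.
Proof.
apply: le_trans (ler_norm _) _; rewrite -sqrtr_sqr -sqrtrM; last first.
  by apply: sumr_ge0 => j _; exact: sqr_ge0.
exact/ler_wsqrtr/cauchy_schwarz_sum.
Qed.

Lemma opnorm_has_ubound A :
  has_ubound [set enorm (v *m A) | v in [set v : 'rV[R]_d | enorm v <= 1]].
Proof.
(* The bound is the Frobenius norm of [A]: Cauchy-Schwarz is applied to [v] and each column of
   [A]. *)
exists (Num.sqrt (\sum_(j < d) \sum_(i < d) A i j ^+ 2)) => _ [v /= v1 <-].
apply: ler_wsqrtr; apply: ler_sum => j _; rewrite mxE.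
apply: le_trans (cauchy_schwarz_sum _ _ _ _) _.
rewrite ler_piMl ?sumr_ge0 // => [i _|]; first exact: sqr_ge0.
by rewrite -enorm_sqr exprn_ile1 ?enorm_ge0.
Qed.

Lemma enorm_mulmx_le v A : enorm (v *m A) <= opnorm A * enorm v.
Proof.
have [/enorm_eq0 ->|v_neq0] := eqVneq (enorm v) 0.
  by rewrite mul0mx enorm0 mulr0.
have v_gt0 : 0 < enorm v by rewrite lt0r v_neq0 enorm_ge0.
rewrite -ler_pdivrMr // mulrC -enormZ ?invr_ge0 ?enorm_ge0 // scalemxAl.
apply: ub_le_sup; first exact: opnorm_has_ubound.
exists ((enorm v)^-1 *: v) => //=.
by rewrite enormZ ?invr_ge0 ?enorm_ge0 // mulVf.
Qed.

End EuclideanNorm.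

Section DerivativeAlongLine.
Context {R : realType} {d : nat}.

(** Both derivatives are limits of the same difference quotient in [h], so derivability in the
    single direction [v] suffices and no chain rule is involved. *)
Lemma is_derive_line (W : normedModType R) (f : 'rV[R]_d -> W)
    (a v : 'rV[R]_d) (t : R) :
  derivable f (a + t *: v) v ->
  is_derive t 1 (fun s : R => f (a + s *: v)) ('D_v f (a + t *: v)).
Proof.
have quotientE : (fun h : R => h^-1 *: (((fun s : R => f (a + s *: v)) \o shift t)
      (h *: 1) - f (a + t *: v))) =
    (fun h : R => h^-1 *: ((f \o shift (a + t *: v)) (h *: v) - f (a + t *: v))).
  apply/funext => h /=; congr (_ *: (f _ - _)).
  by rewrite [h *: 1]mulr1 scalerDl addrCA.
move=> f_v; apply: DeriveDef; first by rewrite /derivable quotientE.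
by rewrite /derive quotientE.
Qed.

Lemma derive_minimizer (f : 'rV[R]_d -> R) (a v : 'rV[R]_d) :
  (forall x, differentiable f x) -> minimizer f a -> 'D_v f a = 0.
Proof.
move=> f_diff a_min.
pose g (s : R) := f (a + s *: v).
have g' (t : R) : is_derive t 1 g ('D_v f (a + t *: v)).
  exact/is_derive_line/diff_derivable.
have g'0 : is_derive (0 : R) 1 g 0.
  (* Any open interval around 0 would do, since [a] is a global minimizer. *)
  apply: (@derive1_at_min R g (-1) 1) => [|t _||t _].
  - lra.
  - by case: (g' t).
  - by rewrite in_itv /=; lra.
  - by rewrite /g scale0r addr0; exact: a_min.
by have := @derive_val _ _ _ _ _ _ _ (g' 0);
  rewrite scale0r addr0 (@derive_val _ _ _ _ _ _ _ g'0).
Qed.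

Lemma grad_minimizer (f : 'rV[R]_d -> R) (a : 'rV[R]_d) :
  (forall x, differentiable f x) -> minimizer f a -> grad f a = 0.
Proof.
by move=> f_diff a_min; apply/rowP => j; rewrite !mxE derive_minimizer.
Qed.

Lemma enorm_sub_le_jacobian (h : 'rV[R]_d -> 'rV[R]_d) (c : R) (a x : 'rV[R]_d) :
  (forall y, differentiable h y) -> (forall y, opnorm ('J h y) <= c) ->
  enorm (h x - h a) <= c * enorm (x - a).
Proof.
move=> h_diff J_le; set u := h x - h a; set v := x - a.
(* The mean value equality needs a scalar function. With [u] held fixed, the increment of [k] from
   [a] to [x] is exactly [enorm u ^+ 2]. *)
pose k y : R := \sum_(j < d) h y 0 j * u 0 j.
have k' y : is_derive y v k (\sum_(j < d) (v *m 'J h y) 0 j * u 0 j).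
  have -> : k = \sum_(j < d) (u 0 j \*: (fun y => h y 0 j) : 'rV[R]_d -> R).
    by apply/funext => z; rewrite fct_sumE; apply: eq_bigr => j _; rewrite mulrC.
  apply: is_derive_sum => j; rewrite mulrC; apply: is_deriveZ.
  have hv : derivable h y v by exact: diff_derivable.
  rewrite -deriveEjacobian // derive_mx // mxE; apply: derivableP.
  by move/derivable_mxP: hv; exact.
pose g (s : R) := k (a + s *: v).
pose dg (s : R) := \sum_(j < d) (v *m 'J h (a + s *: v)) 0 j * u 0 j.
have g' (t : R) : is_derive t 1 g (dg t).
  have kv := k' (a + t *: v).
  rewrite /dg -(@derive_val _ _ _ _ _ _ _ kv).
  by apply: is_derive_line; case: kv.
have [|s _] := @MVT R g dg 0 1 ltr01 (fun t _ => g' t).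
  by apply: derivable_within_continuous => t _; case: (g' t).
rewrite subr0 mulr1 /g scale1r scale0r addr0 subrKC => gs.
have uu : enorm u ^+ 2 = dg s.
  rewrite -gs enorm_sqr /k -sumrB; apply: eq_bigr => j _.
  by rewrite -mulrBl !mxE expr2.
have : enorm u ^+ 2 <= c * enorm v * enorm u.
  rewrite uu; apply: le_trans (sum_mul_le_enorm _ _) _.
  apply: ler_wpM2r; first exact: enorm_ge0.
  apply: le_trans (enorm_mulmx_le _ _) _.
  by apply: ler_wpM2r; [exact: enorm_ge0|exact: J_le].
have [u0 _|u_neq0] := eqVneq (enorm u) 0; last first.
  by rewrite expr2 ler_pM2r // lt0r u_neq0 enorm_ge0.
(* When [u] has norm 0 there is nothing to cancel, and the claim reduces to [0 <= c]. This follows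
   from [J_le], because an operator norm is at least the value attained at the vector 0. *)
rewrite u0 mulr_ge0 ?enorm_ge0 //; apply: le_trans (J_le a).
by rewrite -[leLHS](@enorm0 R d) -(mul0mx _ ('J h a));
  apply: ub_le_sup; [exact: opnorm_has_ubound|exists 0; rewrite //= enorm0].
Qed.

End DerivativeAlongLine.

Section Average.
Context {R : realType} {d M : nat} (r : 'I_M -> 'rV[R]_d -> R).
Hypothesis r_diff : forall m : 'I_M, twice_differentiable (r m).

Lemma averageE : average r = M%:R^-1 *: \sum_(m < M) r m.
Proof. by apply/funext => x; rewrite /average /= fct_sumE. Qed.

(** Stated as an equality of functions, so that differentiability of the gradients [grad (r m)]
    passes to [grad (average r)]. *)
Lemma grad_average : grad (average r) = M%:R^-1 *: \sum_(m < M) grad (r m).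
Proof.
have r_drv m x v : derivable (r m) x v.
  by apply: diff_derivable; case: (r_diff m).
apply/funext => x; apply/rowP => j; rewrite averageE /= mxE.
rewrite [RHS]mxE [in RHS]fct_sumE summxE.
rewrite deriveZ; last exact: derivable_sum.
by rewrite derive_sum //; congr (_ * _); apply: eq_bigr => m _; rewrite mxE.
Qed.

Lemma average_twice_differentiable : twice_differentiable (average r).
Proof.
split=> x.
  by rewrite averageE; apply: differentiableZ; apply: differentiable_sum => m;
    case: (r_diff m).
by rewrite grad_average; apply: differentiableZ; apply: differentiable_sum => m;
  case: (r_diff m).
Qed.

End Average.

Theorem proposition1 (R : realType) (d M : nat) (r : 'I_M -> 'rV[R]_d -> R)
    (xs : 'rV[R]_d) (delta : R)
    (r_diff : forall m : 'I_M, twice_differentiable (r m))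
    (xs_min : minimizer (average r) xs)
    (delta_gt0 : 0 < delta)
    (r_related : forall m : 'I_M, related delta (r m) (average r)) :
  forall (m : 'I_M) (x : 'rV[R]_d),
    enorm (grad (r m) x - grad (average r) x) ^+ 2
      <= sigma_sim_sq r xs + 2 * delta ^+ 2 * enorm (x - xs) ^+ 2.
Proof.
move=> m x; have [avg_diff gavg_diff] := average_twice_differentiable r r_diff.
have [_ gr_diff] := r_diff m.
pose h := grad (r m) - grad (average r).
have h_diff y : differentiable h y by exact: differentiableB.
have J_le y : opnorm ('J h y) <= delta.
  suff -> : 'J h y = hess (r m) y - hess (average r) y by exact: r_related.
  (* Row [i] of a Jacobian is the derivative along the [i]-th basis vector, which is additive in the
     function. *)
  apply/row_matrixP => i.
  rewrite [LHS]rowE [RHS]rowE mulmxBr.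
  have JE f (f_diff : differentiable f y) :=
    esym (deriveEjacobian (delta_mx 0 i) f_diff).
  transitivity ('D_(delta_mx 0 i) h y); first exact: JE.
  rewrite deriveB; [|exact: diff_derivable..].
  by congr (_ - _); apply/esym/JE.
have hxs : h xs = grad (r m) xs.
  rewrite -[LHS]/(grad (r m) xs - grad (average r) xs).
  by rewrite (grad_minimizer _ _ avg_diff xs_min) subr0.
have -> : grad (r m) x - grad (average r) x = h xs + (h x - h xs).
  by rewrite subrKC.
apply: le_trans (enormD_sqr _ _) _; apply: lerD.
  (* The term at [xs] is one of those under the maximum. The remaining term is the squared Lipschitz
     bound. *)
  rewrite hxs /sigma_sim_sq ler_pM2l //.
  by rewrite (bigmax_sup m).
rewrite -mulrA -exprMn ler_pM2l //.
apply: lerXn2r; rewrite ?nnegrE ?mulr_ge0 ?enorm_ge0 ?(ltW delta_gt0) //.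
exact: enorm_sub_le_jacobian.
Qed.
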